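(* Let $m\geq 2$ be an integer and let $p\geq 2m$ be a real number, with conjugate exponent $p^{\ast}$, i.e. $\frac1p+\frac1{p^{\ast}}=1$. Then the optimal constant $C_{\mathbb{R},m,p}$ of the real $m$-linear Hardy--Littlewood inequality on $\ell_p$ satisfies $$C_{\mathbb{R},m,p}\;\geq\; \frac{2^{\frac{2mp+2m-p-2m^{2}}{mp}}}{\displaystyle\sup_{x\in[0,1]}\frac{\left((1+x)^{p^{\ast}}+(1-x)^{p^{\ast}}\right)^{1/p^{\ast}}}{(1+x^{p})^{1/p}}}.$$
   Context: $\ell_p^n$ denotes $\mathbb{R}^n$ with the $\ell_p$ norm, $(e_i)$ is the canonical basis, and for an $m$-linear form $T:\ell_p^n\times\cdots\times\ell_p^n\to\mathbb{R}$ one sets $\|T\|=\sup\{|T(z^{(1)},\ldots,z^{(m)})| : \|z^{(k)}\|_p\le 1,\ 1\le k\le m\}$. For $p\ge 2m$, the Hardy--Littlewood/Praciano-Pereira theorem states that there is a constant $C\ge 1$ (depending only on $m$ and $p$) such that $$\left(\sum_{i_1,\ldots,i_m=1}^{n}|T(e_{i_1},\ldots,e_{i_m})|^{\frac{2mp}{mp+p-2m}}\right)^{\frac{mp+p-2m}{2mp}}\le C\,\|T\|$$ for all positive integers $n$ and all $m$-linear forms $T:\ell_p^n\times\cdots\times\ell_p^n\to\mathbb{R}$. The optimal constant $C_{\mathbb{R},m,p}$ is the smallest such $C$. *)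

(* Defs.v *)
From HB Require Import structures.
From mathcomp Require Import all_boot all_order all_algebra.
From mathcomp Require Import all_classical all_reals all_analysis.

Set Implicit Arguments.
Unset Strict Implicit.
Unset Printing Implicit Defensive.

Import Order.TTheory GRing.Theory Num.Theory.

Local Open Scope classical_set_scope.
Local Open Scope ring_scope.

Definition lp_norm (R : realType) (p : R) (n : nat) (x : 'rV[R]_n) : R :=
  (\sum_(j < n) `|x 0 j| `^ p) `^ p^-1.

Definition multilinear_form (R : realType) (m n : nat)
    (T : ('I_m -> 'rV[R]_n) -> R) : Prop :=
  forall (z : 'I_m -> 'rV[R]_n) (k : 'I_m),
    scalar (fun x : 'rV[R]_n => T (dfwith z k x)).

(* The supremum is taken in R: for p > 0 and T multilinear, the set is nonempty
   (take z = 0) and bounded above, so [sup] never takes its default value. *)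
Definition form_norm (R : realType) (p : R) (m n : nat)
    (T : ('I_m -> 'rV[R]_n) -> R) : R :=
  sup [set `|T z| | z in [set z : 'I_m -> 'rV[R]_n |
                            forall k, lp_norm p (z k) <= 1]].

Definition hl_exponent (R : realType) (m : nat) (p : R) : R :=
  (2 * m%:R * p) / (m%:R * p + p - 2 * m%:R).

Definition hl_sum (R : realType) (p : R) (m n : nat)
    (T : ('I_m -> 'rV[R]_n) -> R) : R :=
  (\sum_(i : {ffun 'I_m -> 'I_n})
      `|T (fun k => delta_mx 0 (i k))| `^ hl_exponent m p)
    `^ ((m%:R * p + p - 2 * m%:R) / (2 * m%:R * p)).

Definition hl_constants (R : realType) (m : nat) (p : R) : set R :=
  [set C : R | 1 <= C /\
    forall (n : nat) (T : ('I_m -> 'rV[R]_n) -> R),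
      (0 < n)%N -> multilinear_form T ->
      hl_sum p T <= C * form_norm p T].

(* The set of admissible constants is closed, so its infimum is the smallest
   admissible constant as soon as the set is nonempty (the Hardy-Littlewood /
   Praciano-Pereira theorem, for p >= 2m). The infimum is taken in \bar R
   because the real [inf] of an empty set is 0, which would mix that existence
   theorem into every lower bound. *)
Definition hl_optimal_constant (R : realType) (m : nat) (p : R) : \bar R :=
  ereal_inf [set C%:E | C in hl_constants m p].

(* Main.v *)
(* Let S be the supremum in the denominator; it is the norm of the bilinear form
   (a, b), (c, d) |-> (a + b) c + (a - b) d on l_p^2, by Hoelder's inequality.
   Nesting this form along a binary tree yields an m-linear form on
   l_p^(2^(m-1)) with exactly 4^(m-1) nonzero coefficients, all equal to +1 or
   -1. As |a + b| + |a - b| = 2 max(|a|, |b|) <= 2, each of the m - 2 upper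
   levels at most doubles the norm, which is therefore at most 2^(m-2) S.
   Testing the Hardy-Littlewood inequality on this form gives the bound. *)
Require Import Defs.
From HB Require Import structures.
From mathcomp Require Import all_boot all_order all_algebra.
From mathcomp Require Import all_classical all_reals all_analysis.
From mathcomp Require Import ring lra zify.

Set Implicit Arguments.
Unset Strict Implicit.
Unset Printing Implicit Defensive.

Import Order.TTheory GRing.Theory Num.Theory.

Local Open Scope classical_set_scope.
Local Open Scope ring_scope.

(* [z k] is the argument in slot k and [w < 2 ^ k] a vertex of depth k, whose
   children are [2w] and [2w + 1]; j is the number of levels below w. *)
Fixpoint tree_form (R : realType) (z : nat -> nat -> R) (j k w : nat) : R :=
  if j is i.+1 then
    (z k w.*2 + z k w.*2.+1) * tree_form z i k.+1 w.*2
    + (z k w.*2 - z k w.*2.+1) * tree_form z i k.+1 w.*2.+1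
  else z k w.

(** * Locality and linearity of the tree form *)

Lemma node_bound (j k w : nat) : (w < 2 ^ k)%N ->
  [/\ w.*2.+1 < 2 ^ k.+1, w.*2 < 2 ^ k.+1, w.*2.+1 < 2 ^ (j.+1 + k)
    & w.*2 < 2 ^ (j.+1 + k)]%N.
Proof.
move=> wk; have h : (w.*2.+1 < 2 ^ k.+1)%N by rewrite expnS; lia.
have h' : (w.*2.+1 < 2 ^ (j.+1 + k))%N.
  by apply: leq_trans h _; rewrite leq_pexp2l// addSn ltnS leq_addl.
by split=> //; apply: ltn_trans (ltnSn _) _.
Qed.

(** The recursion never leaves the subtree below [w]. This makes that subtree independent of
    shallower slots and allows junk values of [z] outside the range. *)
Lemma eq_tree_form (R : realType) (z z' : nat -> nat -> R) (j k w : nat) :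
  (forall l i, (k <= l <= j + k)%N -> (i < 2 ^ (j + k))%N -> z l i = z' l i) ->
  (w < 2 ^ k)%N -> tree_form z j k w = tree_form z' j k w.
Proof.
elim: j k w => [|j IH] k w zz' wk /=; first by rewrite zz' ?leqnn.
have [h1 h2 h3 h4] := node_bound j wk.
have H l i : (k.+1 <= l <= j + k.+1)%N -> (i < 2 ^ (j + k.+1))%N ->
  z l i = z' l i by move=> lk; rewrite -addSnnS => ij; apply: zz' => //; lia.
by rewrite !zz' ?IH// leqnn addSn ltnW// ltnS leq_addl.
Qed.

(** Every monomial has exactly one factor from each depth. At depth [k0] the dependence lies in
    [a + b] and [a - b] only, while the subtrees are fixed; above it, linearity passes up from the
    subtrees, whose coefficients are fixed. *)
Lemma tree_form_linear (R : realType) (a : R) (z u v : nat -> nat -> R)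
    (j k w k0 : nat) :
  (k <= k0 <= j + k)%N -> (w < 2 ^ k)%N ->
  (forall i, z k0 i = a * u k0 i + v k0 i) ->
  (forall l i, (k <= l <= j + k)%N -> l != k0 -> z l i = u l i) ->
  (forall l i, (k <= l <= j + k)%N -> l != k0 -> z l i = v l i) ->
  tree_form z j k w = a * tree_form u j k w + tree_form v j k w.
Proof.
elim: j k w => [|j IH] k w /= k0k wk zk0 zu zv.
  by have -> : k = k0 by lia.
have [h1 h2 h3 h4] := node_bound j wk.
have kk : (k <= k <= j.+1 + k)%N by lia.
case: (eqVneq k k0) => [kk0|kk0].
  have E1 i : (i < 2 ^ k.+1)%N ->
      tree_form u j k.+1 i = tree_form z j k.+1 i.
    by apply: eq_tree_form => l i' lk _; rewrite -zu//; lia.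
  have E2 i : (i < 2 ^ k.+1)%N ->
      tree_form v j k.+1 i = tree_form z j k.+1 i.
    by apply: eq_tree_form => l i' lk _; rewrite -zv//; lia.
  by rewrite !E1// !E2// kk0 !zk0; ring.
have E i : (i < 2 ^ k.+1)%N -> tree_form z j k.+1 i =
    a * tree_form u j k.+1 i + tree_form v j k.+1 i.
  move=> ik; apply: IH => //; first by lia.
  - by move=> l i' lk; apply: zu; lia.
  - by move=> l i' lk; apply: zv; lia.
by rewrite !E// -!zv// !zu//; ring.
Qed.

(** * Coefficients along paths *)

(* A nonzero coefficient amounts to a choice, at each depth k, of the child
   taken by the path, [(d k).1], and of the term picked in [a + b] or [a - b],
   [(d k).2]. *)
Fixpoint node (d : nat -> bool * bool) (k : nat) : nat :=
  if k is i.+1 then (node d i).*2 + (d i).1 else 0.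

(** Index of the basis vector that the path selects in slot [k]: a child of [node d k] above the
    leaves, the vertex itself at leaf depth [M]. *)
Definition coord (M : nat) (d : nat -> bool * bool) (k : nat) : nat :=
  if (k < M)%N then (node d k).*2 + (d k).2 else node d k.

Lemma node_lt (d : nat -> bool * bool) (k : nat) : (node d k < 2 ^ k)%N.
Proof. by elim: k => //= k IH; rewrite expnS; case: (d k).1; lia. Qed.

Lemma coord_lt (M : nat) (d : nat -> bool * bool) (k : nat) :
  (k <= M)%N -> (coord M d k < 2 ^ M)%N.
Proof.
rewrite /coord; case: ifP => [kM _|kM kM']; last first.
  by have -> : k = M by [lia]; exact: node_lt.
have [h1 _ _ _] := node_bound 0 (node_lt d k).
have := leq_trans h1 (leq_pexp2l (isT : 0 < 2)%N kM).
by case: (d k).2; lia.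
Qed.

(** Halving a coordinate recovers the node; the parity of the next node then gives [(d k).1], and
    that of the coordinate gives [(d k).2]. *)
Lemma coord_inj (M : nat) (d e : nat -> bool * bool) :
  (forall k, (k <= M)%N -> coord M d k = coord M e k) ->
  forall k, (k < M)%N -> d k = e k.
Proof.
move=> de.
have nodeE k : (k <= M)%N -> node d k = node e k.
  move=> kM; have := de _ kM; rewrite /coord; case: ifP => // _.
  by case: (d k).2; case: (e k).2; lia.
move=> k kM; have := de _ (ltnW kM); rewrite /coord kM.
have := nodeE k.+1 kM; have := nodeE _ (ltnW kM).
by move=> /= ->; case: (d k) (e k) => [[] []] [[] []] //=; lia.
Qed.

(** The only nonzero entry of slot [k] sits under [node d k], so off the path both entries read at
    [w] vanish. *)
Lemma tree_form_coord_neq (R : realType) (M : nat) (d : nat -> bool * bool)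
    (z : nat -> nat -> R) (j k w : nat) :
  (forall l i, z l i = (i == coord M d l)%:R) -> (j + k)%N = M ->
  w != node d k -> tree_form z j k w = 0.
Proof.
move=> zE jkM wk; case: j jkM => [|j] /= jkM.
  by rewrite zE /coord -jkM ltnn (negbTE wk).
rewrite !zE /coord -jkM ltnS leq_addl.
have -> : (w.*2 == (node d k).*2 + (d k).2)%N = false.
  by case: (d k).2; lia.
have -> : (w.*2.+1 == (node d k).*2 + (d k).2)%N = false.
  by case: (d k).2; lia.
by rewrite addr0 subr0 !mul0r addr0.
Qed.

(** Of the two subtrees only the one on the path survives; its factor is a sum or difference of one
    1 and one 0. *)
Lemma tree_form_coord (R : realType) (M : nat) (d : nat -> bool * bool)
    (z : nat -> nat -> R) (j k : nat) :
  (forall l i, z l i = (i == coord M d l)%:R) -> (j + k)%N = M ->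
  `|tree_form z j k (node d k)| = 1.
Proof.
move=> zE; elim: j k => [|j IH] k jkM /=.
  by rewrite zE /coord -jkM ltnn eqxx normr1.
have jkM' : (j + k.+1)%N = M by lia.
have kM : (k < M)%N by lia.
have {IH} := IH _ jkM'; rewrite !zE /coord kM.
have -> : ((node d k).*2 == (node d k).*2 + (d k).2)%N = ~~ (d k).2.
  by case: (d k).2; lia.
have -> : ((node d k).*2.+1 == (node d k).*2 + (d k).2)%N = (d k).2.
  by case: (d k).2; lia.
have Z := tree_form_coord_neq zE jkM'.
have signs : `|(~~ (d k).2)%:R + (d k).2%:R| = 1 :> R /\
             `|(~~ (d k).2)%:R - (d k).2%:R| = 1 :> R.
  by case: (d k).2; rewrite /= ?add0r ?addr0 ?subr0 ?normrN normr1.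
case Eb: (d k).1; rewrite /= Eb ?addn1 ?addn0 => IH.
  rewrite (Z (node d k).*2) /= ?Eb; last by lia.
  by rewrite mulr0 add0r normrM IH mulr1 signs.2.
rewrite (Z (node d k).*2.+1) /= ?Eb; last by lia.
by rewrite mulr0 addr0 normrM IH mulr1 signs.1.
Qed.

(** * Norm estimates for pairs of coordinates *)

Lemma normr_add_sub (R : realDomainType) (a b : R) : `|b| <= `|a| ->
  (`|a + b| = `|a| + `|b| /\ `|a - b| = `|a| - `|b|) \/
  (`|a + b| = `|a| - `|b| /\ `|a - b| = `|a| + `|b|).
Proof.
by case: (ger0P a) => ?; case: (ger0P b) => ?; case: (ger0P (a + b)) => ?;
  case: (ger0P (a - b)) => ? ?; first [left; split; lra | right; split; lra].
Qed.

Lemma powR_le1 (R : realType) (s r : R) :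
  0 <= r -> 0 <= s -> s <= 1 -> s `^ r <= 1.
Proof.
move=> r0 s0 s1; have -> : 1 = 1 `^ r :> R by rewrite powR1.
by apply: ge0_ler_powR; rewrite ?nnegrE ?ler01.
Qed.

Section two_dimensional.
Variables (R : realType) (p q : R).
Hypotheses (p0 : 0 < p) (q0 : 0 < q).

Definition ratio (x : R) : R :=
  ((1 + x) `^ q + (1 - x) `^ q) `^ (1 / q) / (1 + x `^ p) `^ (1 / p).

Definition sup_ratio : R := sup [set ratio x | x in [set x : R | 0 <= x <= 1]].

Lemma ratio_le_sup (x : R) : 0 <= x <= 1 -> ratio x <= sup_ratio.
Proof.
move=> x01; apply: ub_le_sup; last by exists x.
(* A crude bound makes [sup] genuine: on [0, 1] both bases in the numerator are at most 2 and the
   denominator is at least 1. *)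
exists ((2 `^ q + 2 `^ q) `^ (1 / q)) => _ [y /= /andP[y0 y1] <-].
have den : 1 <= (1 + y `^ p) `^ (1 / p).
  rewrite [leLHS](_ : 1 = 1 `^ (1 / p)); last by rewrite powR1.
  apply: ge0_ler_powR.
  - by rewrite divr_ge0// ltW.
  - by rewrite nnegrE ler01.
  - by rewrite nnegrE addr_ge0// powR_ge0.
  - by rewrite lerDl powR_ge0.
rewrite /ratio ler_pdivrMr; last exact: lt_le_trans ltr01 den.
apply: (@le_trans _ _ ((2 `^ q + 2 `^ q) `^ (1 / q))); last first.
  by rewrite ler_peMr// powR_ge0.
apply: ge0_ler_powR; rewrite ?nnegrE ?addr_ge0 ?powR_ge0//.
  by rewrite divr_ge0// ltW.
by apply: lerD; apply: ge0_ler_powR; rewrite ?nnegrE ?(ltW q0)//; lra.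
Qed.

Lemma sup_ratio_gt0 : 0 < sup_ratio.
Proof.
apply: lt_le_trans (@ratio_le_sup 0 _); last by rewrite lexx ler01.
rewrite /ratio divr_gt0// powR_gt0// ltr_pwDl ?powR_ge0//.
Qed.

(** Both sides are homogeneous of degree one, so dividing by [x] reduces to [ratio] at
    [t = y / x]. *)
Lemma ratio_homogeneous (x y : R) : 0 <= y <= x ->
  ((x + y) `^ q + (x - y) `^ q) `^ (1 / q) <=
  sup_ratio * (x `^ p + y `^ p) `^ (1 / p).
Proof.
move=> /andP[y0 yx].
have [x0|x0] := eqVneq x 0.
  have -> : y = 0 by apply/le_anti; rewrite y0 -x0 yx.
  rewrite x0 addr0 subr0 !powR0 ?addr0 ?gt_eqF ?divr_gt0//.
  by rewrite !powR0 ?mulr0 ?gt_eqF ?divr_gt0.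
have {}x0 : 0 < x by rewrite lt_neqAle eq_sym x0 (le_trans y0 yx).
have [t [t0 t1 ->]] : exists t, [/\ 0 <= t, t <= 1 & y = x * t].
  exists (y / x); split; first by rewrite divr_ge0// ltW.
    by rewrite ler_pdivrMr// mul1r.
  by rewrite mulrC divfK// gt_eqF.
have -> : x + x * t = x * (1 + t) by ring.
have -> : x - x * t = x * (1 - t) by ring.
have X := ltW x0.
have t1' : 0 <= 1 - t by rewrite subr_ge0.
rewrite !powRM ?t1' ?addr_ge0//.
rewrite -mulrDr -[X in _ * (X + _) `^ _]mulr1 -mulrDr.
rewrite !powRM ?addr_ge0 ?powR_ge0// -!powRrM !div1r !divff ?gt_eqF//.
rewrite !powRr1// mulrCA ler_pM2l// -ler_pdivrMr; last first.
  by rewrite powR_gt0// ltr_wpDr ?powR_ge0.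
by have := @ratio_le_sup t; rewrite /ratio !div1r t0 t1; exact.
Qed.

(** This bounds the norm of the map sending [(a, b)] to [(a + b, a - b)]. By symmetry [a] dominates,
    and then the two absolute values are [|a| + |b|] and [|a| - |b|] in some order. *)
Lemma two_point_norm (a b : R) : `|a| `^ p + `|b| `^ p <= 1 ->
  (`|a + b| `^ q + `|a - b| `^ q) `^ (1 / q) <= sup_ratio.
Proof.
wlog ba : a b / `|b| <= `|a|.
  move=> H ab1; have [/H|/ltW ba] := leP `|b| `|a|; first exact.
  by rewrite [a + b]addrC distrC; apply: (H b a ba); rewrite addrC.
move=> ab1; apply: (@le_trans _ _
  (sup_ratio * (`|a| `^ p + `|b| `^ p) `^ (1 / p))).
  rewrite [leLHS](_ : _ = ((`|a| + `|b|) `^ q + (`|a| - `|b|) `^ q) `^ (1 / q)).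
    by apply: ratio_homogeneous; rewrite normr_ge0.
  have [[-> ->]|[-> ->]] := normr_add_sub ba; first reflexivity.
  by rewrite [in LHS]addrC.
by rewrite ler_piMr ?(ltW sup_ratio_gt0)// powR_le1 ?div1r ?invr_ge0 ?addr_ge0
  ?powR_ge0 ?(ltW p0).
Qed.

Hypothesis pq : 1 / p + 1 / q = 1.

Lemma bilinear_bound (a b c d : R) :
  `|a| `^ p + `|b| `^ p <= 1 -> `|c| `^ p + `|d| `^ p <= 1 ->
  `|(a + b) * c + (a - b) * d| <= sup_ratio.
Proof.
move=> ab1 cd1; apply: le_trans (ler_normD _ _) _; rewrite !normrM.
have pq' : q^-1 + p^-1 = 1 by rewrite -pq !div1r addrC.
apply: le_trans (hoelder2 _ _ _ _ q0 p0 pq') _ => //.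
apply: le_trans (two_point_norm ab1); rewrite div1r.
by rewrite ler_piMr ?powR_ge0// powR_le1 ?invr_ge0 ?addr_ge0
  ?powR_ge0 ?(ltW p0).
Qed.

Lemma normr_le1_of_lp (a b : R) : `|a| `^ p + `|b| `^ p <= 1 ->
  `|a| <= 1 /\ `|b| <= 1.
Proof.
have aux (c : R) : `|c| `^ p <= 1 -> `|c| <= 1.
  move=> c1; have -> : `|c| = (`|c| `^ p) `^ p^-1.
    by rewrite -powRrM divff ?powRr1 ?gt_eqF.
  by rewrite powR_le1 ?powR_ge0 ?invr_ge0 ?(ltW p0).
by move=> ab1; split; apply: aux; apply: le_trans ab1;
  rewrite ?lerDl ?lerDr powR_ge0.
Qed.

(** Only sibling pairs are required to lie in the unit ball. The induction starts one level above
    the leaves, with the bilinear form, so [j.+1] levels cost only [j] doublings. *)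
Lemma tree_form_bound (M : nat) (z : nat -> nat -> R) (j k w : nat) :
  (forall l i, (l <= M)%N -> (i.*2.+1 < 2 ^ M)%N ->
     `|z l i.*2| `^ p + `|z l i.*2.+1| `^ p <= 1) ->
  (j.+1 + k)%N = M -> (w < 2 ^ k)%N ->
  `|tree_form z j.+1 k w| <= 2 ^+ j * sup_ratio.
Proof.
move=> zM; elim: j k w => [|j IH] k w jkM wk.
  have [h1 h2 h3 h4] := node_bound 0 wk.
  have h : (w.*2.+1 < 2 ^ M)%N by rewrite -jkM.
  rewrite mul1r; apply: bilinear_bound; last first.
    by have := zM k.+1 w; rewrite -jkM leqnn; apply.
  by apply: zM; [rewrite -jkM leq_addl|].
have [h1 h2 h3 h4] := node_bound j.+1 wk.
have jkM' : (j.+1 + k.+1)%N = M by lia.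
have lkM : (k <= M)%N by lia.
rewrite jkM in h3.
have [a1 b1] := normr_le1_of_lp (zM _ _ lkM h3).
rewrite [tree_form]lock /= -lock.
set B := 2 ^+ j * sup_ratio.
have B0 : 0 <= B by rewrite mulr_ge0 ?exprn_ge0// ltW// sup_ratio_gt0.
have := IH _ _ jkM' h2; have := IH _ _ jkM' h1.
(* Exactly one level is unfolded, so that the induction hypothesis fits both subtrees. *)
rewrite -[tree_form z j.+2 k w]/(_ * tree_form z j.+1 k.+1 w.*2
  + _ * tree_form z j.+1 k.+1 w.*2.+1).
move: (tree_form z _ _ _) (tree_form z _ _ _) => u v uB vB.
have -> : 2 ^+ j.+1 * sup_ratio = 2 * B by rewrite exprS mulrA.
apply: le_trans (ler_normD _ _) _; rewrite !normrM.
apply: (@le_trans _ _ ((`|z k w.*2 + z k w.*2.+1| +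
  `|z k w.*2 - z k w.*2.+1|) * B)).
  by rewrite mulrDl; apply: lerD; apply: ler_wpM2l.
rewrite ler_wpM2r//.
move: a1 b1; rewrite !ler_norml => /andP[? ?] /andP[? ?].
by case: (ger0P (_ + _)) => ?; case: (ger0P (_ - _)) => ?; lra.
Qed.

End two_dimensional.

(** * The tree form on row vectors and its norm *)

(** [inord] needs a nonempty index type, hence [N.+1]. The indices read are below [2 ^ M], so
    nothing is truncated once [2 ^ M <= N.+1]. *)
Definition hl_form (R : realType) (M N : nat)
    (z : 'I_M.+1 -> 'rV[R]_N.+1) : R :=
  tree_form (fun k i => z (inord k) 0 (inord i)) M 0 0.

Lemma hl_form_multilinear (R : realType) (M N : nat) :
  multilinear_form (@hl_form R M N).
Proof.
move=> z k a u v; apply: (@tree_form_linear _ _ _ _ _ _ _ _ k) => //.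
- by have := ltn_ord k; lia.
- by move=> i; rewrite inord_val !dfwithin !mxE.
- move=> l i /andP[_ lM] lk; rewrite !dfwithout//;
    by apply: contraNneq lk => ->; rewrite inordK// ltnS -[M]addn0.
- move=> l i /andP[_ lM] lk; rewrite !dfwithout//;
    by apply: contraNneq lk => ->; rewrite inordK// ltnS -[M]addn0.
Qed.

Lemma lp_norm_pair_le1 (R : realType) (p : R) (N : nat) (x : 'rV[R]_N)
    (i j : 'I_N) : 0 < p -> i != j -> lp_norm p x <= 1 ->
  `|x 0 i| `^ p + `|x 0 j| `^ p <= 1.
Proof.
move=> p0 ij x1.
have s0 : 0 <= \sum_(l < N) `|x 0 l| `^ p.
  by apply: sumr_ge0 => ? _; exact: powR_ge0.
have s1 : \sum_(l < N) `|x 0 l| `^ p <= 1.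
  have -> : \sum_(l < N) `|x 0 l| `^ p = lp_norm p x `^ p.
    by rewrite /lp_norm -powRrM mulVf ?gt_eqF// powRr1.
  by rewrite powR_le1 ?(ltW p0) ?powR_ge0.
apply: le_trans s1; rewrite (bigD1 i)//= (bigD1 j) 1?eq_sym//=.
by rewrite addrA lerDl sumr_ge0// => ? _; exact: powR_ge0.
Qed.

Lemma hl_form_norm (R : realType) (p q : R) (j N : nat) :
  0 < p -> 0 < q -> 1 / p + 1 / q = 1 -> (2 ^ j.+1 <= N.+1)%N ->
  form_norm p (@hl_form R j.+1 N) <= 2 ^+ j * sup_ratio p q.
Proof.
move=> p0 q0 pq jN; apply: ge_sup.
  (* Bounding [sup] from above requires a nonempty set; the zero vectors provide a point. *)
  exists `|@hl_form R j.+1 N (fun=> 0)|; exists (fun=> 0) => //= k.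
  rewrite /lp_norm big1 => [|i _]; last by rewrite mxE normr0 powR0 ?gt_eqF.
  by rewrite powR0 ?ler01// invr_eq0 gt_eqF.
move=> _ [z /= z1 <-]; apply: (tree_form_bound p0 q0 pq (M := j.+1)) => //.
  move=> l i lj ij; apply: lp_norm_pair_le1 => //.
  have iN := leq_trans ij jN.
  by rewrite -val_eqE /= !inordK//; lia.
by rewrite addn0.
Qed.

(** * Lower bound for the coefficient sum *)

(** Paths become a finite type, so that they can be counted. The default fills depths from [M] on,
    which [coord M] never reads in slots up to [M]. *)
Definition path_of (M : nat) (f : {ffun 'I_M -> bool * bool}) (k : nat) :
    bool * bool :=
  oapp f (false, false) (insub k).

Definition support_index (M N : nat) (f : {ffun 'I_M -> bool * bool}) :
    {ffun 'I_M.+1 -> 'I_N.+1} :=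
  [ffun k : 'I_M.+1 => inord (coord M (path_of f) k)].

Lemma support_index_inj (M N : nat) : (2 ^ M <= N.+1)%N ->
  injective (@support_index M N).
Proof.
move=> MN f g /ffunP fg; apply/ffunP => k.
have E : forall l, (l < M)%N -> path_of f l = path_of g l.
  apply: coord_inj => l lM; have := fg (inord l); rewrite !ffunE.
  move=> /(congr1 val); rewrite /= !inordK//.
  - exact: leq_trans (coord_lt _ lM) MN.
  - exact: leq_trans (coord_lt _ lM) MN.
by have := E k (ltn_ord k); rewrite /path_of valK.
Qed.

Lemma hl_form_support (R : realType) (M N : nat)
    (f : {ffun 'I_M -> bool * bool}) : (2 ^ M <= N.+1)%N ->
  `|hl_form (fun k => delta_mx 0 (support_index N f k) : 'rV[R]_N.+1)| = 1.
Proof.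
move=> MN; rewrite /hl_form.
rewrite (@eq_tree_form _ _ (fun l i => (i == coord M (path_of f) l)%:R)) //.
  by have := @tree_form_coord R M (path_of f) _ M 0 (fun _ _ => erefl)
    (addn0 M).
move=> l i; rewrite addn0 => /andP[_ lM] iM; rewrite mxE /= ffunE inordK//.
rewrite -val_eqE /= !inordK//; first exact: leq_trans (coord_lt _ lM) MN.
exact: leq_trans iM MN.
Qed.

(** The [4 ^ M] paths give distinct multi-indices, each contributing 1; the other terms are
    nonnegative and are dropped. *)
Lemma hl_sum_lower (R : realType) (p : R) (M N : nat) :
  (2 ^ M <= N.+1)%N -> 0 < p -> 0 <= M.+1%:R * p + p - 2 * M.+1%:R ->
  (2 ^+ (2 * M)) `^ ((M.+1%:R * p + p - 2 * M.+1%:R) / (2 * M.+1%:R * p))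
  <= hl_sum p (@hl_form R M N).
Proof.
move=> MN p0 e0; apply: ge0_ler_powR.
- by rewrite divr_ge0// !mulr_ge0// ltW.
- by rewrite nnegrE exprn_ge0.
- by rewrite nnegrE; apply: sumr_ge0 => i _; exact: powR_ge0.
pose A := (@support_index M N @: predT)%SET.
rewrite (bigID [in A]) /=.
rewrite [leLHS](_ : _ = \sum_(i in A) (1 : R)).
  rewrite -[leLHS]addr0; apply: lerD; last first.
    by apply: sumr_ge0 => i _; exact: powR_ge0.
  by apply: ler_sum => _ /imsetP[f _ ->]; rewrite hl_form_support// powR1.
rewrite sumr_const card_imset; last exact: support_index_inj.
by rewrite card_ffun card_prod !card_bool card_ord exprM natrX natrM expr2.
Qed.

(** * Testing the inequality on the tree form *)

Theorem theorem2p1 (R : realType) (m : nat) (p pstar : R)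
  (hm : (2 <= m)%N) (hp : 2 * m%:R <= p) (hpstar : 1 / p + 1 / pstar = 1) :
  ((2 `^ ((2 * m%:R * p + 2 * m%:R - p - 2 * m%:R ^+ 2) / (m%:R * p))
    / sup [set ((1 + x) `^ pstar + (1 - x) `^ pstar) `^ (1 / pstar)
                 / (1 + x `^ p) `^ (1 / p)
          | x in [set x : R | 0 <= x <= 1]])%:E
   <= hl_optimal_constant m p)%E.
Proof.
case: m hm hp => // -[//|j] _ hp.
set m := j.+2 in hp *.
have m0 : 0 < m%:R :> R by rewrite ltr0n.
have m2 : 2 <= m%:R :> R by rewrite ler_nat.
have p0 : 0 < p by lra.
have q0 : 0 < pstar.
  rewrite -invr_gt0 -div1r.
  have -> : 1 / pstar = 1 - p^-1 by move: hpstar; rewrite !div1r; lra.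
  by rewrite subr_gt0 invf_lt1//; lra.
rewrite -/(sup_ratio p pstar); apply: le_ereal_inf_tmp => _ [C [C1 HC] <-].
rewrite lee_fin ler_pdivrMr ?sup_ratio_gt0//.
(* With [m = j.+2] the tree has [j.+1] levels; the dimension [N.+1] is its number of leaves. *)
pose N := (2 ^ j.+1).-1.
have NE : N.+1 = (2 ^ j.+1)%N by rewrite prednK// expn_gt0.
have jN : (2 ^ j.+1 <= N.+1)%N by rewrite NE.
have := HC _ _ (ltn0Sn N) (@hl_form_multilinear R j.+1 N).
have e0 : 0 <= m%:R * p + p - 2 * m%:R by nra.
move=> /(le_trans (hl_sum_lower jN p0 e0)) H.
have {}H := le_trans H (ler_wpM2l (le_trans ler01 C1)
  (hl_form_norm p0 q0 hpstar jN)).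
rewrite [C * _]mulrCA [leRHS]mulrC -ler_pdivrMr ?exprn_gt0// in H.
apply: le_trans H.
rewrite -[2 ^+ (2 * _)]powR_mulrn// -[2 ^+ j]powR_mulrn// -powRrM -powRB;
  last by rewrite pnatr_eq0 implybT.
(* Both sides are powers of 2. With n for [m], the exponents agree: [(n - 1) * (n * p + p - 2 * n) /
   (n * p) - (n - 2)] equals the exponent claimed. *)
rewrite le_eqVlt; apply/orP; left; apply/eqP; congr (_ `^ _).
have -> : (2 * j.+1)%:R = 2 * (m%:R - 1) :> R.
  by rewrite natrM /m -[j.+2]addn1 natrD addrK.
have -> : j%:R = m%:R - 2 :> R by rewrite /m -addn2 natrD addrK.
rewrite -/m; move: (m%:R) m0 => n n0.
by field; rewrite !gt_eqF.
Qed.
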